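(* Let $T=\{z\in\mathbb{C}:|z|=1\}$, and for $p>0$ and $n\ge 1$ let $M_n^p(T)$ be the $n$th $L_p$ Chebyshev constant of $T$. There exist a positive constant $c_0$ (independent of $p$ and $n$) and, for each $p\ge 1$, a positive constant $c_p$ (depending only on $p$) such that for every integer $n\ge 1$: \[ M_n^p(T) < \frac{c_0\, n}{1-p}\quad\text{for } 0<p<1, \] \[ M_n^1(T) < c_1\, n(1+\ln n)\quad\text{for } p=1, \] \[ M_n^p(T) < c_p\, n^p\quad\text{for } p>1. \]
   Context: For $p>0$ and points $z_1,\dots,z_n\in T$ (not necessarily distinct), set \[ M^p(z_1,\dots,z_n)=\min_{z\in T}\sum_{k=1}^n\frac{1}{|z-z_k|^p}, \] where $1/|z-z_k|^p$ is interpreted as $+\infty$ when $z=z_k$. The $n$th $L_p$ Chebyshev constant of $T$ is \[ M_n^p(T)=\max_{z_1,\dots,z_n\in T} M^p(z_1,\dots,z_n). \] Here $\ln$ is the natural logarithm. *)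

(* Defs.v *)
From HB Require Import structures.
From mathcomp Require Import all_boot all_order all_algebra.
From mathcomp Require Import all_classical all_reals all_analysis.
From mathcomp Require Import complex.

Set Implicit Arguments.
Unset Strict Implicit.
Unset Printing Implicit Defensive.

Import Order.TTheory GRing.Theory Num.Theory.
Import numFieldNormedType.Exports.

Local Open Scope classical_set_scope.
Local Open Scope ring_scope.
Local Open Scope complex_scope.

(* [normc] is the modulus valued in [R] itself: [`|z| = (normc z)%:C]. *)
Notation cmod := ComplexField.Normc.normc.

Definition unit_circle (R : realType) : set R[i] := [set z | cmod z = 1].

Definition inv_dist_pow (R : realType) (p : R) (z w : R[i]) : \bar R :=
  if z == w then +oo%E else ((cmod (z - w) `^ p)^-1)%:E.

Definition Mp (R : realType) (p : R) (n : nat) (zs : 'I_n -> R[i]) : \bar R :=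
  ereal_inf [set (\sum_(k < n) inv_dist_pow p z (zs k))%E
            | z in @unit_circle R].

Definition Lp_Chebyshev (R : realType) (p : R) (n : nat) : \bar R :=
  ereal_sup [set Mp p zs
            | zs in [set zs : 'I_n -> R[i] | forall k, unit_circle (zs k)]].

(* For p > 0 the infimum and the supremum above are attained, i.e., they are a
   minimum and a maximum: see [Mp_min] and [Lp_Chebyshev_max]. *)

Section Attained.
Variable R : realType.
Implicit Types (p : R) (u v : R * R).

Lemma compact_ereal_max (X : topologicalType) (K : set X) (f : X -> \bar R) :
  compact K -> K !=set0 -> (forall a, closed [set x | (a <= f x)%E]) ->
  exists2 x, K x & forall y, K y -> (f y <= f x)%E.
Proof.
move=> cK [x0 Kx0] clf.
have S0 : f @` K != set0 by apply/set0P; exists (f x0), x0.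
have [s Ks scvg] := ereal_sup_seq S0.
have /choice[t tP] : forall i, exists x, K x /\ f x = s i.
  by move=> i; have [x Kx <-] := Ks i; exists x.
have [[y Ky ey]|nmax] := pselect (exists2 y, K y & f y = ereal_sup (f @` K)).
  by exists y => // w Kw; rewrite ey; apply: ereal_sup_ubound; exists w.
have FK : (t @ \oo) K by exists 0%N => // i _; exact: (tP i).1.
have [x [Kx clx]] := cK _ _ FK.
exists x => // y Ky.
have ylt : (f y < ereal_sup (f @` K))%E.
  rewrite lt_neqAle; apply/andP; split.
    by apply/eqP => ey; apply: nmax; exists y.
  by apply: ereal_sup_ubound; exists y.
have Fy : (t @ \oo) [set z | (f y <= f z)%E].
  have : (s @ \oo) [set z | (f y < z)%E].
    by apply: scvg; exact:
      (open_nbhs_nbhs (conj (@open_ereal_gt_ereal R (f y)) ylt)).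
  apply: (@filterS _ \oo _ [set i | (f y < s i)%E]) => i /=.
  by rewrite (tP i).2 => /ltW.
by move: clx; rewrite clusterE => /(_ _ Fy) /clf.
Qed.

Let cx (u : R * R) : R[i] := u.1 +i* u.2.

Let rad (uv : (R * R) * (R * R)) : R :=
  (uv.1.1 - uv.2.1) ^+ 2 + (uv.1.2 - uv.2.2) ^+ 2.

Let h p (r : R) : \bar R :=
  if r == 0 then +oo%E else ((`|r| `^ p)^-1)%:E.

Let inv_dist_powE p u v :
  inv_dist_pow p (cx u) (cx v) = h p (Num.sqrt (rad (u, v))).
Proof.
case: u v => [a b] [c d]; rewrite /inv_dist_pow /h /cx /rad /=.
rewrite (_ : _ == 0 = ((a +i* b) == (c +i* d))).
  by case: ifP => // _; rewrite ger0_norm ?sqrtr_ge0.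
rewrite sqrtr_eq0 le_eqVlt ltNge addr_ge0 ?sqr_ge0// orbF.
by rewrite paddr_eq0 ?sqr_ge0// !sqrf_eq0 !subr_eq0 eq_complex.
Qed.

Let h_continuous p : 0 < p -> continuous (h p).
Proof.
move=> p0 r; have [->|r0] := eqVneq r 0.
  rewrite /continuous_at {2}/h eqxx; apply/cvgeyPge => A.
  pose M := Num.max A 1.
  have M0 : 0 < M by rewrite lt_max ltr01 orbT.
  pose d := M^-1 `^ p^-1.
  have d0 : 0 < d by rewrite powR_gt0 ?invr_gt0.
  have dp : d `^ p = M^-1.
    by rewrite -powRrM mulVf ?lt0r_neq0// powRr1// invr_ge0 ltW.
  near=> x; rewrite /h; case: ifPn => [|x0]; first by rewrite leey.
  rewrite lee_fin (@le_trans _ _ M) ?le_max ?lexx//.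
  rewrite -[M]invrK lef_pV2 ?posrE ?invr_gt0// ?powR_gt0 ?normr_gt0//.
  have xd : `|x| < d.
    near: x.
    by exists d => //= x /=; rewrite sub0r normrN.
  rewrite -dp; apply: (ge0_ler_powR (ltW p0)); last exact: ltW.
    by rewrite nnegrE.
  by rewrite nnegrE ltW.
have rn0 : 0 < `|r| by rewrite normr_gt0.
rewrite /continuous_at {2}/h (negPf r0).
apply: cvg_trans.
  apply: (@near_eq_cvg _ _ _ _ (fun x : R => ((expR (p * ln `|x|))^-1)%:E)).
  near=> x; have x0 : x != 0.
    near: x; exists `|r| => //= x /=; apply: contraTneq => ->.
    by rewrite subr0 ltxx.
  by rewrite /h (negPf x0) /powR normr_eq0 (negPf x0).
rewrite /powR normr_eq0 (negPf r0).
apply: cvg_EFin; first exact: nearW.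
apply: cvgV; first by rewrite gt_eqF ?expR_gt0.
apply: (@continuous_comp _ _ _ (fun x : R => p * ln `|x|) (@expR R)).
  apply: cvgM; first exact: cvg_cst.
  apply: (@continuous_comp _ _ _ (fun x : R => `|x|) (@ln R)).
    exact: norm_continuous.
  exact: continuous_ln.
exact: continuous_expR.
Unshelve. all: by end_near. Qed.

Let rad_continuous : continuous rad.
Proof.
have c11 : continuous (fun uv : (R * R) * (R * R) => uv.1.1).
  by move=> uv; apply: (@continuous_comp _ _ _ fst fst); exact: cvg_fst.
have c12 : continuous (fun uv : (R * R) * (R * R) => uv.1.2).
  move=> uv; apply: (@continuous_comp _ _ _ fst snd); first exact: cvg_fst.
  exact: cvg_snd.
have c21 : continuous (fun uv : (R * R) * (R * R) => uv.2.1).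
  move=> uv; apply: (@continuous_comp _ _ _ snd fst); first exact: cvg_snd.
  exact: cvg_fst.
have c22 : continuous (fun uv : (R * R) * (R * R) => uv.2.2).
  by move=> uv; apply: (@continuous_comp _ _ _ snd snd); exact: cvg_snd.
move=> uv; rewrite /rad.
apply: cvgD; under eq_fun do rewrite expr2; rewrite expr2; apply: cvgM;
  apply: cvgB; solve [exact: c11|exact: c12|exact: c21|exact: c22].
Qed.

Let kern_continuous p : 0 < p ->
  continuous (fun uv => inv_dist_pow p (cx uv.1) (cx uv.2)).
Proof.
move=> p0 uv.
rewrite (_ : (fun _ => _) = h p \o (Num.sqrt \o rad)); last first.
  by apply/funext => -[u v] /=; rewrite inv_dist_powE.
apply: continuous_comp; last exact: h_continuous.
by apply: continuous_comp; [exact: rad_continuous|exact: sqrt_continuous].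
Qed.

Let inv_dist_pow_ge0 p z w : (0 <= inv_dist_pow p z w)%E.
Proof.
by rewrite /inv_dist_pow; case: ifP => // _; rewrite lee_fin invr_ge0 powR_ge0.
Qed.

Let circ : set (R * R) := [set u | unit_circle (cx u)].

Let circ_compact : compact circ.
Proof.
refine (@subclosed_compact (R * R)%type circ
  (`[-1, 1]%classic `*` `[-1, 1]%classic) _ _ _).
- rewrite (_ : circ = (fun u => Num.sqrt (rad (u, 0))) @^-1` [set x | x = 1]).
    apply: preimage_closed; last exact: closed_eq.
    move=> u _; apply: (@continuous_comp _ _ _
      (fun u : R * R => rad (u, 0)) Num.sqrt).
      apply: (@continuous_comp _ _ _ (fun u : R * R => (u, 0 : R * R)) rad).
        exact: (@cvg_pair _ _ _ (nbhs u) (nbhs u) (nbhs (0 : R * R)) _ _ _ id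
          (cst (0 : R * R)) cvg_id (cvg_cst _)).
      exact: rad_continuous.
    exact: sqrt_continuous.
  by apply/seteqP; split => -[a b]; rewrite /circ /rad/= !subr0.
- by apply: compact_setX; exact: segment_compact.
move=> [a b] ab1; have {}ab1 : a ^+ 2 + b ^+ 2 = 1.
  have <- : Num.sqrt (a ^+ 2 + b ^+ 2) ^+ 2 = a ^+ 2 + b ^+ 2.
    by rewrite sqr_sqrtr// addr_ge0 ?sqr_ge0.
  by rewrite [Num.sqrt _]ab1 expr1n.
by split; rewrite /= in_itv /= -ler_norml -(@expr_le1 _ 2)// real_normK ?num_real//
  -ab1 ?lerDl ?lerDr sqr_ge0.
Qed.

Let circ_surj z : unit_circle z -> exists2 u, circ u & cx u = z.
Proof. by case: z => a b zT; exists (a, b). Qed.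

Let unit_circle1 : unit_circle (1 : R[i]).
Proof. exact: ComplexField.Normc.normc1. Qed.

Lemma Mp_min p n (zs : 'I_n -> R[i]) : 0 < p ->
  exists2 z, unit_circle z &
    Mp p zs = (\sum_(k < n) inv_dist_pow p z (zs k))%E.
Proof.
move=> p0.
pose us k := (complex.Re (zs k), complex.Im (zs k)).
have usE k : cx (us k) = zs k by rewrite /cx /us; case: (zs k).
pose f u := (\sum_(k < n) inv_dist_pow p (cx u) (zs k))%E.
have fc : continuous f.
  move=> u; apply: cvg_nnesum => [k _|k _].
    by apply: nearW => v; exact: inv_dist_pow_ge0.
  rewrite -(usE k).
  apply: (@continuous_comp _ _ _ (fun v => (v, us k))
    (fun uv => inv_dist_pow p (cx uv.1) (cx uv.2))).
    exact: (@cvg_pair _ _ _ (nbhs u) (nbhs u) (nbhs (us k)) _ _ _ id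
          (cst (us k)) cvg_id (cvg_cst _)).
  exact: kern_continuous.
have circ0 : circ !=set0.
  by have [u cu _] := circ_surj unit_circle1; exists u.
have [|u cu umax] := @compact_ereal_max _ _
    (fun u => - f u)%E circ_compact circ0.
  move=> a; rewrite (_ : [set _ | _] = f @^-1` [set x | (x <= - a)%E]).
    apply: preimage_closed; last exact: closed_ereal_ge_ereal.
    by move=> x _; exact: fc.
  by apply/seteqP; split => x /=; rewrite leeNr.
exists (cx u) => //.
apply/eqP; rewrite eq_le; apply/andP; split.
  by apply: ereal_inf_lbound; exists (cx u).
apply: le_ereal_inf_tmp => _ [z /circ_surj[v cv <-] <-].
by have := umax _ cv; rewrite leeN2.
Qed.

Lemma Lp_Chebyshev_max p n : 0 < p ->
  exists2 zs : 'I_n -> R[i], (forall k, unit_circle (zs k)) &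
    Lp_Chebyshev p n = Mp p zs.
Proof.
move=> p0.
pose X := (prod_topology (fun _ : 'I_n => (R * R)%type)) : topologicalType.
have cK := tychonoff (fun _ : 'I_n => circ_compact).
have [||us /= cus usmax] := compact_ereal_max
    (X := prod_topology (fun _ : 'I_n => (R * R)%type))
    (f := fun us : 'I_n -> R * R => Mp p (fun k => cx (us k))) cK.
- by have [u cu _] := circ_surj unit_circle1; exists (fun _ => u).
- move=> a.
  rewrite (_ : [set _ | _] = \bigcap_(z in @unit_circle R)
     [set us | (a <= \sum_(k < n) inv_dist_pow p z (cx (us k)))%E]); last first.
    apply/seteqP; split => us /=.
      move=> aM z Tz; apply: le_trans aM _.
      by apply: ereal_inf_lbound; exists z.
    by move=> H; apply: le_ereal_inf_tmp => _ [z Tz <-]; exact: H.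
  apply: closed_bigI => z /circ_surj[u cu <-].
  apply: (@preimage_closed X _
    (fun us => \sum_(k < n) inv_dist_pow p (cx u) (cx (us k)))%E
    [set x | (a <= x)%E]); last exact: closed_ereal_le_ereal.
  move=> us _; apply: (@cvg_nnesum _ _ (@nbhs_pfilter X us)) => [k _|k _].
    by apply: nearW => v; exact: inv_dist_pow_ge0.
  apply: (@continuous_comp X _ _
    (fun us => (u, us k))
    (fun uv => inv_dist_pow p (cx uv.1) (cx uv.2))).
    exact: (@cvg_pair _ _ _ (nbhs us) (nbhs u) (nbhs (us k)) _ _ _ (cst u)
      (proj k) (cvg_cst _) (@proj_continuous _ _ k us)).
  exact: kern_continuous.
exists (cx \o us) => //.
apply/eqP; rewrite eq_le; apply/andP; split; last first.
  by apply: ereal_sup_ubound; exists (cx \o us).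
apply: ge_ereal_sup => _ [zs Tzs <-].
have -> : zs = cx \o (fun k => (complex.Re (zs k), complex.Im (zs k))).
  by apply/funext => k /=; rewrite /cx; case: (zs k).
by apply: usmax => k; rewrite /circ /= /cx /=; have := Tzs k; case: (zs k).
Qed.

End Attained.

(* Main.v *)
Require Import Defs.
From mathcomp Require Import all_boot all_order all_algebra.
From mathcomp Require Import all_classical all_reals all_analysis.
From mathcomp Require Import complex ring lra zify.

(** Put [N = 4n] and test only the [N] points [w_j] of [T] with abscissa [j/N] and
    nonnegative ordinate. Projecting on the real axis, [w_j] is at distance at
    least [m/N] from a given [z_k] with [m = gap f_k j], and every [m] is attained
    by at most two [j]. Hence at most [2n] of the [w_j] are too close to some
    [z_k], and averaging [\sum_k |w_j - z_k|^-p] over the others yields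
    [M_n^p <= (4n)^p * 3/2 * \sum_(1 <= m <= 4n) m^-p]. The sum is then bounded
    by telescoping, using [1/(m+1) <= ln (m+1) - ln m]. *)

Import Order.TTheory GRing.Theory Num.Theory.
Local Open Scope ring_scope.

(** * Distribution of the gaps over the grid *)

(* A lower bound of [`|j - x|] valid for all [x] in [[f, f + 1]]; it vanishes
   exactly at [j = f] and [j = f + 1]. *)
Definition gap (f j : nat) : nat :=
  if (j <= f)%N then (f - j)%N else (j - f.+1)%N.

Lemma gap_le_dist (R : realType) (x : R) (j : nat) :
  0 <= x -> (gap (Num.truncn x) j)%:R <= `|j%:R - x|.
Proof.
move=> /truncn_itv/andP[fx xf]; rewrite /gap.
case: leqP => jf; rewrite natrB//.
  by rewrite distrC; apply: le_trans (ler_norm _); rewrite lerB.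
by apply: le_trans (ler_norm _); rewrite lerB// ltW.
Qed.

Lemma sum_gap_le (R : realType) (phi : nat -> R) (f N : nat) :
  (forall m, 0 <= phi m) -> (f <= N)%N ->
  \sum_(0 <= j < N) phi (gap f j) <= 2 * \sum_(0 <= m < N.+1) phi m.
Proof.
move=> phi0 fN.
have widen a b : (a <= b)%N ->
    \sum_(0 <= j < a) phi j <= \sum_(0 <= j < b) phi j.
  by move=> ab; rewrite (big_cat_nat (leq0n a) ab)//= lerDl sumr_ge0.
(* With the range enlarged to [f.+1 + N], the first [f.+1] indices have gaps [f, ..., 0] and the
   other [N] have gaps [0, ..., N - 1]: no value repeats within either half. *)
apply: (@le_trans _ _ (\sum_(0 <= j < f.+1 + N) phi (gap f j))).
  by rewrite (@big_cat_nat _ _ _ N 0 (f.+1 + N)) ?leq_addl//= lerDl sumr_ge0.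
rewrite (@big_cat_nat _ _ _ f.+1 0 (f.+1 + N)) ?leq_addr//= mulr_natl mulr2n.
apply: lerD.
  rewrite big_nat_rev/= (_ : \sum_(_ <= _ < _) _ = \sum_(0 <= j < f.+1) phi j).
    exact: widen.
  apply: eq_big_nat => j /andP[_ jf]; rewrite /gap; congr phi.
  by rewrite ifT; lia.
rewrite -{1}[f.+1]add0n big_addn addKn.
rewrite (_ : \sum_(_ <= _ < _) _ = \sum_(0 <= j < N) phi j).
  exact: widen.
by apply: eq_bigr => j _; rewrite /gap ifF; [congr phi; lia | lia].
Qed.

(* Giving the value [2 * H] to a vanishing gap makes the average over [j] at
   most [3/2 * H], so that some [j] reaches the average with no gap zero. *)
Lemma exists_good_index (R : realType) (phi : nat -> R) (n : nat) (f : 'I_n -> nat)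
    (H := \sum_(1 <= m < (4 * n).+1) phi m) :
  (0 < n)%N -> (forall m, 0 <= phi m) -> 0 < H -> (forall k, f k <= 4 * n)%N ->
  exists2 j : nat, (j < 4 * n)%N /\ (forall k, 0 < gap (f k) j)%N &
    \sum_(k < n) phi (gap (f k) j) <= 3 / 2 * H.
Proof.
move=> n0 phi0 H0 fN.
pose psi m := if m is _.+1 then phi m else 2 * H.
have psi0 m : 0 <= psi m.
  by case: m => [|m]; rewrite /psi ?phi0// mulr_ge0// ltW.
have psiS : \sum_(0 <= m < (4 * n).+1) psi m = 3 * H.
  rewrite big_nat_recl//=.
  rewrite (_ : \sum_(0 <= i < 4 * n) phi i.+1 = H); first by ring.
  by rewrite /H big_add1.
(* Each [k] contributes at most [2 * (3 * H)], so the average over the [4 * n] indices is at most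
   [3/2 * H], below the value [2 * H] that marks a zero gap. *)
have tot : \sum_(0 <= j < 4 * n) \sum_(k < n) psi (gap (f k) j) <=
    (4 * n)%:R * (3 / 2 * H).
  rewrite exchange_big/=.
  rewrite (_ : _ * (3 / 2 * H) = \sum_(k < n) 2 * (3 * H)); last first.
    by rewrite sumr_const card_ord -mulr_natl natrM; field.
  by apply: ler_sum => k _; rewrite -psiS; apply: sum_gap_le.
have [[j jN jle]|nj] := pselect (exists2 j, (j < 4 * n)%N &
    \sum_(k < n) psi (gap (f k) j) <= 3 / 2 * H); last first.
  have : (4 * n)%:R * (3 / 2 * H) <
      \sum_(0 <= j < 4 * n) \sum_(k < n) psi (gap (f k) j).
    rewrite (_ : _ * (3 / 2 * H) = \sum_(0 <= j < 4 * n) 3 / 2 * H); last first.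
      by rewrite sumr_const_nat subn0 mulr_natl.
    apply: ltr_sum_nat; first by rewrite muln_gt0.
    move=> j /andP[_ jN]; rewrite ltNge; apply/negP => jle.
    by apply: nj; exists j.
  by rewrite ltNge tot.
have gap0 k : (0 < gap (f k) j)%N.
  rewrite lt0n; apply/eqP => gk.
  have : 2 * H <= 3 / 2 * H.
    apply: le_trans jle; rewrite (bigD1 k)//= gk /= lerDl.
    by apply: sumr_ge0.
  by move: H0; lra.
exists j => //; apply: le_trans jle; rewrite le_eqVlt; apply/orP; left.
apply/eqP; apply: eq_bigr => k _; by have := gap0 k; case: (gap (f k) j).
Qed.

(** * From the circle to a power sum *)

Lemma Lp_Chebyshev_le (R : realType) (p : R) (n : nat) : 0 < p -> (0 < n)%N ->
  (Lp_Chebyshev p n <= ((4 * n)%:R `^ p *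
     (3 / 2 * \sum_(1 <= m < (4 * n).+1) (m%:R `^ p)^-1))%:E)%E.
Proof.
move=> p0 n0; apply: ge_ereal_sup => _ [zs /= zsT <-].
have N0 : 0 < (4 * n)%:R :> R by rewrite ltr0n; lia.
have Re1 k : `|complex.Re (zs k)| <= 1.
  have := zsT k; rewrite /unit_circle/=; case: (zs k) => a b /= <-.
  by rewrite -sqrtr_sqr ler_sqrt ?lerDl ?sqr_ge0// addr_ge0 ?sqr_ge0.
(* Folding the abscissa of [zs k] into [[0, 1]] costs nothing: the test abscissas [t] are
   nonnegative, so [|t - |a|| <= |t - a|]. *)
pose x k := (4 * n)%:R * `|complex.Re (zs k)|.
have x0 k : 0 <= x k by rewrite mulr_ge0// ltW.
have xN k : (Num.truncn (x k) <= 4 * n)%N.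
  rewrite truncn_le_nat; apply: (@le_lt_trans _ _ (4 * n)%:R).
    by rewrite /x ler_piMr// ltW.
  by rewrite ltr_nat.
have H0 : 0 < \sum_(1 <= m < (4 * n).+1) (m%:R `^ p)^-1 :> R.
  rewrite big_ltn; last by lia.
  rewrite ltr_pwDl// ?invr_gt0 ?powR_gt0//.
  by apply: sumr_ge0 => m _; rewrite invr_ge0 powR_ge0.
have [|j [jN gap0] jle] := exists_good_index R (fun m => (m%:R `^ p)^-1) n
    (fun k => Num.truncn (x k)) n0 _ H0 xN.
  by move=> m; rewrite invr_ge0 powR_ge0.
pose t : R := j%:R / (4 * n)%:R.
have t01 : 0 <= t <= 1.
  by rewrite divr_ge0 ?ler0n//= ler_pdivrMr// mul1r ler_nat ltnW.
pose w : R[i] := Complex t (Num.sqrt (1 - t ^+ 2)).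
have wT : unit_circle w.
  rewrite /unit_circle/= sqr_sqrtr ?subrKC ?sqrtr1//.
  by case/andP: t01 => t0 t1; rewrite subr_ge0 expr_le1.
apply: (@le_trans _ _ (\sum_(k < n) inv_dist_pow p w (zs k))%E).
  by apply: ereal_inf_lbound; exists w.
apply: (@le_trans _ _ (\sum_(k < n) ((4 * n)%:R `^ p *
    ((gap (Num.truncn (x k)) j)%:R `^ p)^-1)%:E)%E); last first.
  by rewrite sumEFin lee_fin -mulr_sumr ler_wpM2l ?powR_ge0.
apply: lee_sum => k _.
set g := (gap _ j)%:R.
have g0 : 0 < g :> R by rewrite ltr0n gap0.
have gle : g / (4 * n)%:R <= cmod (w - zs k).
  have : g <= `|j%:R - x k| by exact: gap_le_dist.
  rewrite (_ : j%:R - x k = (4 * n)%:R * (t - `|complex.Re (zs k)|)); last first.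
    by rewrite mulrBr /t mulrCA divff ?mulr1// gt_eqF.
  rewrite normrM (ger0_norm (ltW N0)) mulrC -ler_pdivrMr// => /le_trans; apply.
  apply: (@le_trans _ _ `|t - complex.Re (zs k)|).
    rewrite -[X in X - `|_|](ger0_norm (proj1 (andP t01))).
    exact: ler_dist_dist.
  case: (zs k) => a b /=.
  by rewrite -sqrtr_sqr ler_sqrt ?lerDl ?sqr_ge0// addr_ge0 ?sqr_ge0.
have gN0 : 0 < g / (4 * n)%:R by rewrite divr_gt0.
have d0 := lt_le_trans gN0 gle.
(* A positive gap keeps [w] away from every [zs k], which excludes the value [+oo]. *)
rewrite /inv_dist_pow; case: eqP => [wz|_].
  by move: d0; rewrite wz subrr ComplexField.Normc.normc0 ltxx.
rewrite lee_fin -[X in X * _]invrK -invfM lef_pV2 ?posrE; last 2 first.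
- exact: powR_gt0.
- by rewrite mulr_gt0 ?invr_gt0 ?powR_gt0.
rewrite -powR_inv1 ?powR_ge0// powRAC -powRM ?powR_ge0 ?(ltW g0)// powR_inv1 ?(ltW N0)//.
by rewrite mulrC ge0_ler_powR ?nnegrE ?(ltW gN0) ?(ltW d0) ?(ltW p0).
Qed.

(** * Power sums by telescoping *)

(** The term [m = 1] is kept apart because [F] may be a logarithm or a negative power, with no
    meaningful value at 0. *)
Lemma sum_le_telescope (R : realType) (phi F : nat -> R) (N : nat) : (0 < N)%N ->
  (forall m, (0 < m)%N -> phi m.+1 <= F m.+1 - F m) ->
  \sum_(1 <= m < N.+1) phi m <= phi 1%N + (F N - F 1%N).
Proof.
move=> N0 phiF; rewrite big_ltn// lerD2l -(telescope_sumr F)// big_add1/=.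
by apply: ler_sum_nat => m /andP[m0 _]; exact: phiF.
Qed.

(** This is [ln (1 + x) <= x] at [x = - 1 / (m + 1)]. *)
Lemma inv_le_lnS (R : realType) (m : nat) : (0 < m)%N ->
  m.+1%:R^-1 <= ln m.+1%:R - ln m%:R :> R.
Proof.
move=> m0; have mp : 0 < m%:R :> R by rewrite ltr0n.
have m1 : 0 < m.+1%:R :> R by rewrite ltr0n.
rewrite -[leRHS]opprB lerNr -ln_div ?posrE//.
rewrite (_ : m%:R / m.+1%:R = 1 + - m.+1%:R^-1).
  by apply: le_ln1Dx; rewrite ltrN2 invf_lt1// ltr1n.
by rewrite -[m.+1%:R]natr1; field; rewrite natr1 gt_eqF.
Qed.

Lemma sum_inv_le (R : realType) (N : nat) : (0 < N)%N ->
  \sum_(1 <= m < N.+1) (m%:R `^ 1)^-1 <= 1 + ln N%:R :> R.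
Proof.
move=> N0.
apply: (le_trans (sum_le_telescope R _ (fun m => ln m%:R) _ N0 _)) => [m m0|].
  by rewrite powRr1//; exact: inv_le_lnS.
by rewrite powRr1// invr1 ln1 subr0.
Qed.

Lemma powR_nat_expR (R : realType) (a : R) (m : nat) : (0 < m)%N ->
  m%:R `^ a = expR (a * ln m%:R).
Proof. by move=> m0; rewrite /powR gt_eqF// ltr0n. Qed.

Lemma inv_powR_nat (R : realType) (p : R) (m : nat) : (0 < m)%N ->
  (m%:R `^ p)^-1 = m%:R `^ (1 - p) / m%:R.
Proof.
move=> m0; rewrite -powRN -powR_inv1// -powRD; first by congr powR; ring.
by rewrite pnatr_eq0 -lt0n m0 implybT.
Qed.

Lemma sum_powR_gt1_le (R : realType) (p : R) (N : nat) : 1 < p -> (0 < N)%N ->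
  \sum_(1 <= m < N.+1) (m%:R `^ p)^-1 <= 1 + (p - 1)^-1.
Proof.
move=> p1 N0; have q0 : 0 < p - 1 by rewrite subr_gt0.
(* A primitive of [x^-p]; its increments are bounded below through [expR y >= 1 + y]. *)
pose G m : R := - ((p - 1)^-1 * m%:R `^ (1 - p)).
apply: (le_trans (sum_le_telescope R _ G _ N0 _)) => [m m0|]; last first.
  rewrite powR1 invr1 lerD2l /G powR1 mulr1 opprK gerDr oppr_le0.
  by rewrite mulr_ge0 ?powR_ge0// invr_ge0 ltW.
have L := inv_le_lnS R m m0.
have m1 : 0 < m.+1%:R :> R by rewrite ltr0n.
rewrite /G opprK addrC -mulrBr ler_pdivlMl//.
rewrite inv_powR_nat//.
have -> : m%:R `^ (1 - p) =
    m.+1%:R `^ (1 - p) * expR ((p - 1) * (ln m.+1%:R - ln m%:R)).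
  by rewrite !powR_nat_expR// -expRD; congr expR; ring.
rewrite -[X in _ <= _ - X]mulr1 -mulrBr mulrCA ler_pM2l ?powR_gt0// lerBrDl.
apply: le_trans (expR_ge1Dx _); rewrite lerD2l.
by rewrite ler_pM2l.
Qed.

Lemma sum_powR_lt1_le (R : realType) (p : R) (N : nat) : 0 < p < 1 -> (0 < N)%N ->
  \sum_(1 <= m < N.+1) (m%:R `^ p)^-1 <= 2 / (1 - p) * N%:R `^ (1 - p).
Proof.
move=> /andP[p0 p1] N0; have s0 : 0 < 1 - p by rewrite subr_gt0.
(* Twice a primitive of [x^-p]: the factor 2 absorbs the loss in [1 - 1 / (1 + u) >= u / 2]. *)
pose G m : R := 2 / (1 - p) * m%:R `^ (1 - p).
apply: (le_trans (sum_le_telescope R _ G _ N0 _)) => [m m0|]; last first.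
  rewrite powR1 invr1 /G powR1 mulr1 addrCA gerDl subr_le0.
  by rewrite ler_pdivlMr// mul1r; lra.
have L := inv_le_lnS R m m0.
have m1 : 0 < m.+1%:R :> R by rewrite ltr0n.
rewrite inv_powR_nat//.
have mE : m%:R `^ (1 - p) =
    m.+1%:R `^ (1 - p) / expR ((1 - p) * (ln m.+1%:R - ln m%:R)).
  by rewrite !powR_nat_expR// -expRN -expRD; congr expR; ring.
rewrite /G mE -mulrBr; set A := m.+1%:R `^ _; set E := expR _.
rewrite (_ : A - A / E = A * (1 - E^-1)); last by rewrite mulrBr mulr1.
rewrite mulrCA ler_pM2l ?powR_gt0//.
pose u := (1 - p) / m.+1%:R.
have u0 : 0 < u by rewrite divr_gt0.
have u1 : u <= 1.
  rewrite ler_pdivrMr// mul1r; apply: (@le_trans _ _ 1); first lra.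
  by rewrite ler1n.
have eu : E^-1 <= (1 + u)^-1.
  rewrite lef_pV2 ?posrE ?expR_gt0 ?addr_gt0//.
  by apply: le_trans (expR_ge1Dx _); rewrite lerD2l ler_pM2l.
(* [1 / (1 + u) <= 1 - u / 2] on [[0, 1]] *)
have uu : (1 + u)^-1 <= 1 - u / 2.
  by rewrite -[leLHS]mul1r ler_pdivrMr ?addr_gt0//; nra.
have -> : m.+1%:R^-1 = u / (1 - p) by rewrite /u; field; rewrite !gt_eqF.
rewrite [2 / _ * _]mulrAC ler_pM2r ?invr_gt0//.
lra.
Qed.

(** * Constants in the three ranges of [p] *)

Theorem proposition2 (R : realType) :
  exists2 c0 : R, 0 < c0 &
  exists2 c : R -> R, (forall p : R, 1 <= p -> 0 < c p) &
  forall n : nat, (1 <= n)%N ->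
    [/\ forall p : R, 0 < p < 1 ->
          (Lp_Chebyshev p n < (c0 * n%:R / (1 - p))%:E)%E,
        (Lp_Chebyshev (1 : R) n < (c 1 * n%:R * (1 + ln n%:R))%:E)%E &
        forall p : R, 1 < p ->
          (Lp_Chebyshev p n < (c p * n%:R `^ p)%:E)%E].
Proof.
have ln4 : 0 < ln 4 :> R by rewrite ln_gt0// ltr1n.
(* The bound obtained is [12 * n / (1 - p)]; 13 makes it strict. Likewise 7 replaces 6 for [p = 1],
   and 2 replaces 3/2 for [p > 1]. *)
exists 13; first by [].
exists (fun p => if p == 1 then 7 * (1 + ln 4)
  else 4 `^ p * (2 * (1 + (p - 1)^-1))) => [p p1|n n0].
  case: eqP => [_|/eqP np]; first by rewrite mulr_gt0// addr_gt0.
  rewrite mulr_gt0 ?powR_gt0// mulr_gt0// addr_gt0// invr_gt0 subr_gt0.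
  by rewrite lt_neqAle eq_sym np.
have nR : 0 < n%:R :> R by rewrite ltr0n.
have N0 : (0 < 4 * n)%N by lia.
have N0R : 0 < (4 * n)%:R :> R by rewrite ltr0n.
split=> [p pI||p p1].
- have /andP[p0 p1] := pI; have s0 : 0 < 1 - p by rewrite subr_gt0.
  apply: (le_lt_trans (Lp_Chebyshev_le R p n p0 n0)); rewrite lte_fin.
  apply: (@le_lt_trans _ _ ((4 * n)%:R `^ p *
      (3 / 2 * (2 / (1 - p) * (4 * n)%:R `^ (1 - p))))).
    by rewrite ler_wpM2l ?powR_ge0// ler_wpM2l//; exact: sum_powR_lt1_le.
  rewrite [ltLHS](_ : _ =
    3 / (1 - p) * ((4 * n)%:R `^ p * (4 * n)%:R `^ (1 - p))); last first.
    by field; rewrite gt_eqF.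
  (* The powers of [4 * n] multiply to [4 * n] itself, so [c0] does not depend on [p]. *)
  rewrite -powRD ?subrKC ?oner_eq0//.
  rewrite powRr1 ?ltW// natrM mulrAC ltr_pM2r ?invr_gt0//.
  lra.
- rewrite eqxx; apply: (le_lt_trans (Lp_Chebyshev_le R 1 n ltr01 n0)).
  have lnn : 0 <= ln n%:R :> R by rewrite ln_ge0// ler1n.
  rewrite lte_fin powRr1 ?ltW//.
  apply: (@le_lt_trans _ _ ((4 * n)%:R * (3 / 2 * (1 + ln (4 * n)%:R)))).
    by rewrite ler_pM2l// ler_wpM2l//; exact: sum_inv_le.
  rewrite natrM lnM ?posrE//.
  rewrite [ltLHS](_ : _ = 6 * (1 + (ln 4 + ln n%:R)) * n%:R); last by field.
  rewrite [ltRHS]mulrAC ltr_pM2r//.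
  (* Uses [1 + ln 4 + ln n <= (1 + ln 4) * (1 + ln n)]. *)
  nra.
have p0 : 0 < p by exact: lt_trans p1.
apply: (le_lt_trans (Lp_Chebyshev_le R p n p0 n0)); rewrite lte_fin gt_eqF//.
rewrite natrM powRM// mulrAC ltr_pM2r ?powR_gt0// ltr_pM2l ?powR_gt0//.
apply: (@le_lt_trans _ _ (3 / 2 * (1 + (p - 1)^-1))).
  by rewrite ler_wpM2l//; exact: sum_powR_gt1_le.
rewrite ltr_pM2r; first lra.
by rewrite addr_gt0// invr_gt0 subr_gt0.
Qed.
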